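(* Let $r\ge 2$, and let $\operatorname{Ferm}(1)$, $\operatorname{Bos}(1)\in\mathcal A$ and the reduction $E\mapsto[E]$ be as defined in the context. Then the following identity holds in $\mathcal A$: $$[\operatorname{Ferm}(1)\times\operatorname{Bos}(1)]=1.$$
   Context: Fix an integer $r\ge 2$ and the alphabet $\mathbb A=\{1,2,\dots,r\}$. A biword is a $2\times n$ matrix $\alpha=\binom{x_1\cdots x_n}{a_1\cdots a_n}$ ($n\ge 0$) with entries in $\mathbb A$, of length $\ell(\alpha)=n$, viewed as the word $\binom{x_1}{a_1}\cdots\binom{x_n}{a_n}$ in biletters; the product of biwords is concatenation, the empty biword is the unit $1$, and $\mathcal B$ is the set of all biwords. A biword has a double descent at position $i$ if $x_i>x_{i+1}$ and $a_i\ge a_{i+1}$; it is irreducible if it has no double descent; $\mathcal B_{\rm irr}$ is the set of irreducible biwords. $\mathcal A=\mathbb Z\langle\langle\mathcal B\rangle\rangle$ is the $\mathbb Z$-algebra of all (possibly infinite) formal sums (''expressions'') $E=\sum_{\alpha\in\mathcal B}c(\alpha)\alpha$, $c(\alpha)\in\mathbb Z$, with product $\times$ induced by concatenation; $\mathbb Z\langle\mathcal B\rangle$ is the subalgebra of finite sums. An expression is irreducible if $c(\alpha)=0$ for all $\alpha\notin\mathcal B_{\rm irr}$. $E^{(n)}=\sum_{\ell(\alpha)=n}c(\alpha)\alpha$ (a finite sum) is the degree-$n$ homogeneous component. For $x>y$ in $\mathbb A$ put $$\left[{xy\atop ab}\right]=\binom{yx}{ba}+\binom{yx}{ab}-\binom{xy}{ba}\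 \ (a>b),\qquad \left[{xy\atop aa}\right]=\binom{yx}{aa}\ \ (\text{all }a).$$ The reduction $E\mapsto [E]$ on $\mathbb Z\langle\mathcal B\rangle$ is the $\mathbb Z$-linear map into finite irreducible expressions determined by: $[E]=E$ if $E$ is irreducible; for $x>y$, $a\ge b$ the value on $\binom{xy}{ab}$ is $\left[{xy\atop ab}\right]$ above; and for a biword $\alpha\notin\mathcal B_{\rm irr}$ factorized as $\alpha=\beta\binom{xy}{ab}\gamma$ with $\beta,\gamma\in\mathcal B$, $x>y$, $a\ge b$, and $\beta\binom{x}{a}\in\mathcal B_{\rm irr}$ (so the first double descent is at $\binom{xy}{ab}$), $[\alpha]=\bigl[\beta\left[{xy\atop ab}\right]\gamma\bigr]$. (This recursion terminates and is well defined.) It is extended to $\mathcal A$ by $[E]=\sum_{n\ge0}[E^{(n)}]$. For a word $w=w_1\cdots w_n$, $\operatorname{inv}w=\#\{(i,j):i<j,\ w_i>w_j\}$. Define $$\operatorname{Ferm}(1)=\sum_{J\subset\mathbb A}(-1)^{|J|}\sum_{\sigma\in\mathfrak S_J}(-1)^{\operatorname{inv}\sigma}\binom{\sigma(i_1)\,\sigma(i_2)\cdots\sigma(i_l)}{i_1\,i_2\cdots i_l},\qquad \operatorname{Bos}(1)=\sum_w \binom{\overline w}{w},$$ where $J=\{i_1<i_2<\cdots<i_l\}$ runs over all subsets of $\mathbb A$ (including $\emptyset$), $\mathfrak S_J$ is the permutation group of $J$, $\operatorname{inv}\sigma=\operatorname{inv}(\sigma(i_1)\cdots\sigma(i_l))$,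 $w$ runs over all words on $\mathbb A$ (including the empty word), and $\overline w$ is the nondecreasing rearrangement of $w$. *)

(* Defs.v *)
From HB Require Import structures.
From mathcomp Require Import all_boot all_order all_fingroup all_algebra.
From mathcomp Require Import zify.

Set Implicit Arguments.
Unset Strict Implicit.
Unset Printing Implicit Defensive.

Import GRing.Theory.
Local Open Scope ring_scope.

(* The alphabet {1, ..., r} is 'I_r, with its order (letters shifted by 1). *)
Definition word (r : nat) := seq 'I_r.
Definition biletter (r : nat) := ('I_r * 'I_r)%type.
(* The biletter (x, a) has x in the top row and a in the bottom row. *)
Definition biword (r : nat) := seq (biletter r).

(* The biword with top row u and bottom row w, for size u = size w. *)
Definition biw r (u w : word r) : biword r := zip u w.

Definition dd r (u v : biletter r) : bool :=
  (v.1 < u.1)%N && (v.2 <= u.2)%N.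

(* "sorted" tests consecutive biletters only: no double descent. *)
Definition irreducible r (al : biword r) : bool :=
  sorted (fun u v => ~~ dd u v) al.

(* An element of Z<<B>> is its coefficient function. *)
Definition expr (r : nat) := biword r -> int.

Definition mono r (al : biword r) : expr r := fun de => (de == al)%:R.

Definition eone r : expr r := mono [::].

Definition emul r (E F : expr r) : expr r :=
  fun de => \sum_(i < (size de).+1) E (take i de) * F (drop i de).

Declare Scope expr_scope.
Delimit Scope expr_scope with X.
Notation "E ** F" := (emul E F) (at level 40, left associativity) : expr_scope.
Local Open Scope expr_scope.

Definition irreducible_expr r (E : expr r) : Prop :=
  forall al : biword r, ~~ irreducible al -> E al = 0.

(* The value of the reduction on the biword u v of length 2, for dd u v, i.e.
   u = (x, a) and v = (y, b) with x > y and a >= b. *)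
Definition rule r (u v : biletter r) : expr r :=
  let: (x, a) := u in let: (y, b) := v in
  if a == b then mono [:: (y, a); (x, a)]
  else fun de => mono [:: (y, b); (x, a)] de + mono [:: (y, a); (x, b)] de
                 - mono [:: (x, b); (y, a)] de.

(* The factorization al = be u v ga at the first double descent u v of al. *)
Fixpoint first_dd r (al : biword r) :
    option (biword r * biletter r * biletter r * biword r) :=
  match al with
  | u :: ((v :: ga) as al') =>
      if dd u v then Some ([::], u, v, ga)
      else if first_dd al' is Some (be, u', v', ga')
           then Some (u :: be, u', v', ga') else None
  | _ => None
  end.

(* sum_n f(E^(n)), where f is extended linearly to homogeneous components
   (which are finite sums) and f maps each biword of length n to an expression
   homogeneous of degree n: only the biwords of the length of de contribute to
   the coefficient of de. *)
Definition linext r (f : biword r -> expr r) (E : expr r) : expr r :=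
  fun de => \sum_(al : (size de).-tuple (biletter r)) E al * f al de.

(* k bounds the depth of the recursion. Each step decreases strictly the total
   number of inversions of the two rows, which is at most (size al) ^ 2, so that
   the bound is never reached in reduce; see reduce_dd. *)
Fixpoint reduce_rec r (k : nat) (al : biword r) : expr r :=
  match k, first_dd al with
  | k'.+1, Some (be, u, v, ga) =>
      linext (reduce_rec k') (mono be ** rule u v ** mono ga)
  | _, _ => mono al
  end.

Definition reduce r : expr r -> expr r :=
  linext (fun al => reduce_rec (size al ^ 2) al).

Definition inv r (w : word r) : nat :=
  #|[set ij : 'I_(size w) * 'I_(size w) |
       (ij.1 < ij.2)%N
       && (tnth (in_tuple w) ij.2 < tnth (in_tuple w) ij.1)%N]|.

(* enum J lists J = {i_1 < ... < i_l} increasingly. *)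
Definition Ferm (r : nat) : expr r :=
  fun de =>
    \sum_(J : {set 'I_r}) (-1) ^+ #|J| *
      \sum_(s in Sym J)
        (-1) ^+ inv (map s (enum J)) * mono (biw (map s (enum J)) (enum J)) de.

Definition nondec r (w : word r) : word r :=
  sort (fun i j : 'I_r => (i <= j)%N) w.

(* Only the words w of the length of de contribute to the coefficient of de. *)
Definition Bos (r : nat) : expr r :=
  fun de => \sum_(w : (size de).-tuple 'I_r) mono (biw (nondec w) w) de.

Arguments eone : clear implicits.
Arguments Ferm : clear implicits.
Arguments Bos : clear implicits.

(* The reduction satisfies its defining recursion. *)

Lemma first_dd_cat r (be ga : biword r) u v :
  irreducible (rcons be u) -> dd u v ->
  first_dd (be ++ u :: v :: ga) = Some (be, u, v, ga).
Proof.
move=> + duv; elim: be => [|b [|c be] IH] /=; first by rewrite duv.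
  by rewrite andbT => /negbTE ->; rewrite duv.
by rewrite /irreducible /= => /andP[/negbTE -> /IH] /= ->.
Qed.

Lemma first_dd_irr r (al : biword r) :
  irreducible al -> first_dd al = None.
Proof.
elim: al => [|u [|v al] IH] //=; rewrite /irreducible /=.
by move=> /andP[/negbTE -> /IH] /= ->.
Qed.

Lemma first_ddP r (al : biword r) :
  match first_dd al with
  | Some (be, u, v, ga) =>
      [/\ al = be ++ u :: v :: ga, irreducible (rcons be u) & dd u v]
  | None => irreducible al
  end.
Proof.
elim: al => [|u [|v al] IH] //.
have -> : first_dd (u :: v :: al) = if dd u v then Some ([::], u, v, al)
    else if first_dd (v :: al) is Some (be, u', v', ga)
         then Some (u :: be, u', v', ga) else None by [].
case: ifP => [duv //|nduv]; move: IH.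
case: (first_dd (v :: al)) => [[[[be u'] v'] ga]|] /=.
  move=> [e ir d]; split=> //; first by rewrite e.
  move: ir e; rewrite /irreducible; case: be => [|c be] /=.
    by move=> _ [<- _]; rewrite nduv.
  by move=> -> [<- _]; rewrite nduv.
by rewrite /irreducible /= nduv.
Qed.

Lemma inv_cons r x (w : word r) :
  inv (x :: w) = (count (fun y : 'I_r => (y < x)%N) w + inv w)%N.
Proof.
have invE (s : word r) : inv s = (\sum_(i < size s) \sum_(j < size s)
    ((i < j) && (nth x s j < nth x s i)))%N.
  rewrite /inv -sum1_card big_mkcond pair_bigA /=; apply: eq_bigr => -[i j] _.
  by rewrite inE /= !(tnth_nth x) /=; case: (_ && _).
rewrite !invE /= big_ord_recl; congr addn.
  rewrite big_ord_recl /= add0n -sum1_count big_mkcond (big_nth x) big_mkord.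
  by rewrite [RHS]big_mkcond; apply: eq_bigr => i _; case: (_ < _)%N.
by apply: eq_bigr => i _; rewrite big_ord_recl add0n.
Qed.

Lemma inv_swap r (be ga : word r) (x y : 'I_r) :
  (y < x)%N -> inv (be ++ x :: y :: ga) = (inv (be ++ y :: x :: ga)).+1.
Proof.
move=> yx; elim: be => [|b be IH] /=; rewrite !inv_cons ?IH.
  by rewrite /= yx ltnNge (ltnW yx) /=; lia.
by rewrite !count_cat /=; lia.
Qed.

Lemma inv_bound r (w : word r) : (2 * inv w <= size w ^ 2)%N.
Proof.
elim: w => [|x w IH].
  by rewrite /inv /= eq_card0 // => -[[]].
rewrite inv_cons /=; have := count_size (fun y : 'I_r => (y < x)%N) w.
by move: IH; rewrite -!mulnn; nia.
Qed.

Definition biinv r (al : biword r) : nat := (inv (unzip1 al) + inv (unzip2 al))%N.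

Lemma biinv_bound r (al : biword r) : (biinv al <= size al ^ 2)%N.
Proof.
have := inv_bound (unzip1 al); have := inv_bound (unzip2 al).
by rewrite /biinv !size_map; move: (size al ^ 2)%N => N; lia.
Qed.

Lemma biinv_gt0 r (be ga : biword r) u v :
  dd u v -> (0 < biinv (be ++ u :: v :: ga))%N.
Proof.
by case/andP=> vu _; rewrite /biinv /unzip1 map_cat /= inv_swap.
Qed.

Lemma mono_neq0 r (al de : biword r) : mono al de != 0 -> de = al.
Proof. by rewrite /mono; case: (de =P al). Qed.

Lemma emul_neq0 r (E F : expr r) de : (E ** F) de != 0 ->
  exists al ga, [/\ de = al ++ ga, E al != 0 & F ga != 0].
Proof.
move=> nz; have [i Hi] : exists i : 'I_(size de).+1,
    E (take i de) * F (drop i de) != 0.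
  apply/existsP; apply: contraNT nz => /existsPn H.
  by rewrite /emul big1 // => i _; apply/eqP; rewrite -[_ == _]negbK H.
exists (take i de), (drop i de); rewrite cat_take_drop; split=> //;
  by apply: contraNneq Hi => ->; rewrite ?mul0r ?mulr0.
Qed.

Lemma rule_neq0 r (be ga : biword r) u v de : dd u v ->
  (mono be ** rule u v ** mono ga) de != 0 ->
  (biinv de < biinv (be ++ u :: v :: ga))%N /\
  size de = size (be ++ u :: v :: ga).
Proof.
move=> duv /emul_neq0[? [? [-> /emul_neq0[? [rho [-> + nz]]]]]].
move=> /mono_neq0-> /mono_neq0->; case: u v duv nz => x a [y b].
rewrite /dd /= => /andP[yx ba].
rewrite -catA /biinv /unzip1 /unzip2 !map_cat /= !size_cat /=.
have yxE (p q : word r) := inv_swap p q yx.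
case: (a =P b) => [ab|/eqP ab] nz.
  by move/mono_neq0: nz => -> /=; rewrite yxE ab; lia.
have {}ba : (b < a)%N by rewrite ltn_neqAle ba andbT eq_sym.
have baE (p q : word r) := inv_swap p q ba.
have [e|[e|e]] : rho = [:: (y, b); (x, a)] \/
    rho = [:: (y, a); (x, b)] \/ rho = [:: (x, b); (y, a)].
- move: nz; rewrite /mono.
  case: (rho =P [:: (y, b); (x, a)]) => [->|_]; first by left.
  case: (rho =P [:: (y, a); (x, b)]) => [->|_]; first by right; left.
  by case: (rho =P [:: (x, b); (y, a)]) => [->|_ //]; right; right.
- by rewrite e /= baE yxE; lia.
- by rewrite e /= yxE; lia.
- by rewrite e /= baE; lia.
Qed.

Lemma eq_linext r (f g : biword r -> expr r) (E : expr r) :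
  (forall al, E al != 0 -> f al =1 g al) -> linext f E =1 linext g E.
Proof.
move=> fg de; apply: eq_bigr => al _.
by have [->|/fg->] := eqVneq (E al) 0; rewrite ?mul0r.
Qed.

Lemma reduce_recE r k k' (al : biword r) :
  (biinv al <= k)%N -> (biinv al <= k')%N ->
  reduce_rec k al =1 reduce_rec k' al.
Proof.
elim: k k' al => [|k IH] [|k'] al //= lek lek'; have := first_ddP al;
  case: (first_dd al) => [[[[be u] v] ga]|] // [e _ d].
- by have := biinv_gt0 be ga d; rewrite -e; move: lek; rewrite leqn0 => /eqP->.
- by have := biinv_gt0 be ga d; rewrite -e; move: lek'; rewrite leqn0 => /eqP->.
apply: eq_linext => al' /(rule_neq0 d)[lt _].
rewrite -e in lt.
by apply: IH; rewrite -ltnS; [apply: leq_trans lek | apply: leq_trans lek'].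
Qed.

Lemma reduce_rec_size r k (al de : biword r) :
  reduce_rec k al de != 0 -> size de = size al.
Proof.
case: k => [/mono_neq0->//|k] /=; have := first_ddP al.
case: (first_dd al) => [[[[be u] v] ga]|] => [[-> _ d] nz|_ /mono_neq0->//].
have [al' /(rule_neq0 d)[_ <-]] : exists al' : (size de).-tuple (biletter r),
    (mono be ** rule u v ** mono ga) al' != 0.
  apply/existsP; apply: contraNT nz => /existsPn H; rewrite /linext big1 // => i _.
  by move: (H i); rewrite negbK => /eqP->; rewrite mul0r.
by rewrite size_tuple.
Qed.

Lemma reduce_mono r (al : biword r) :
  reduce (mono al) =1 reduce_rec (size al ^ 2) al.
Proof.
move=> de; rewrite /reduce /linext.
have [sz|sz] := eqVneq (size al) (size de); last first.
  rewrite big1 => [|t _].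
    by apply/esym/eqP; apply: contra_neqT sz => /reduce_rec_size->.
  by rewrite /mono; case: eqP => [e|_]; [rewrite -e size_tuple eqxx in sz|rewrite mul0r].
have st : size al == size de by apply/eqP.
rewrite (bigD1 (Tuple st)) //= big1 => [|t nt].
  by rewrite /mono eqxx mul1r addr0.
rewrite /mono; case: eqP => [e|_]; last by rewrite mul0r.
by case/eqP: nt; apply: val_inj.
Qed.

Lemma reduce_dd r (be ga : biword r) u v :
  dd u v -> irreducible (rcons be u) ->
  reduce (mono (be ++ u :: v :: ga)) =1
  reduce (mono be ** rule u v ** mono ga).
Proof.
move=> d ir de; rewrite reduce_mono; set al := be ++ _.
have sz : (0 < size al ^ 2)%N by rewrite expn_gt0 /al size_cat /= addnS.
rewrite -(prednK sz) /= first_dd_cat //.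
apply: eq_linext => al' /(rule_neq0 d)[lt _]; apply: reduce_recE.
  by rewrite -ltnS (prednK sz); apply: leq_trans lt (biinv_bound _).
exact: biinv_bound.
Qed.

Lemma reduce_id r (E : expr r) : irreducible_expr E -> reduce E =1 E.
Proof.
move=> ir de; rewrite /reduce /linext (bigD1 (in_tuple de)) //= big1 => [|t nt].
  rewrite addr0; have [/first_dd_irr e|/ir->] := boolP (irreducible de).
    by case: (_ ^ _)%N => [|k] /=; rewrite ?e /mono eqxx mulr1.
  by rewrite mul0r.
have [/first_dd_irr e|/ir->] := boolP (irreducible t); last by rewrite mul0r.
have -> : reduce_rec (size t ^ 2) t = mono t.
  by case: (_ ^ _)%N => [|k] /=; rewrite ?e.
rewrite /mono; case: eqP => [E0|_]; last by rewrite mulr0.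
by case/eqP: nt; apply: val_inj.
Qed.

Lemma reduce_irreducible r (E : expr r) : irreducible_expr (reduce E).
Proof.
have rec_irr k (al de : biword r) : (biinv al <= k)%N -> ~~ irreducible de ->
    reduce_rec k al de = 0.
  elim: k al de => [|k IH] al de lek ir /=; have := first_ddP al;
    case: (first_dd al) => [[[[be u] v] ga]|] => [[e _ d]|ir'].
  - by have := biinv_gt0 be ga d; rewrite -e; move: lek; rewrite leqn0 => /eqP->.
  - by rewrite /mono; case: eqP => // e; rewrite e ir' in ir.
  - apply: big1 => t _.
    have [->|/(rule_neq0 d)[lt _]] :=
      eqVneq ((mono be ** rule u v ** mono ga) t) 0; first by rewrite mul0r.
    by rewrite IH ?mulr0 // -ltnS; apply: leq_trans lek; rewrite e.
  - by rewrite /mono; case: eqP => // e; rewrite e ir' in ir.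
move=> de ir; apply: big1 => t _.
by rewrite rec_irr ?mulr0 ?biinv_bound.
Qed.

(* Main.v *)
(* Leftmost reduction satisfies the diamond lemma, so a coefficient of [al], as a
   function of al, is a linear form f on Z<B> that vanishes on the ideal of the
   relations: it depends only on the class of al in the right quantum algebra.
   By these relations, summing f over all arrangements of a bottom word makes it
   symmetric in the top word, and alternating over the permutations of a top word
   makes it alternating in the bottom word. Fix the content m of the letters of a
   term of Ferm(1) x Bos(1); its contribution is the alternating trace, over the
   subsets J of m, of the matrices by which the biletters act on the Koszul
   complex Lambda^J (x) S^(m - J). They commute with the Koszul differential, and
   inserting or removing the largest letter of m contracts the complex, hence the
   trace vanishes unless m is empty. *)
From mathcomp Require Import all_boot all_order all_fingroup all_algebra.
From mathcomp Require Import zify ring.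
From Stdlib Require Import FunctionalExtensionality.
Require Import Defs.

Set Implicit Arguments.
Unset Strict Implicit.
Unset Printing Implicit Defensive.

Import GRing.Theory.
Local Open Scope ring_scope.
Local Open Scope expr_scope.

(** * Right quantum relations and the diamond lemma for leftmost reduction *)

(** These are the relations of a Manin matrix: entries in one column commute, and cross commutators
    agree. The negative term of [rule] has been moved across, which makes the relation invariant
    under exchanging x with y or a with b. *)
Definition rq_at r (f : biword r -> int) be ga (x y a b : 'I_r) : Prop :=
  f (be ++ [:: (x, a), (y, b) & ga]) + f (be ++ [:: (x, b), (y, a) & ga])
  = f (be ++ [:: (y, b), (x, a) & ga]) + f (be ++ [:: (y, a), (x, b) & ga]).

(* For a = b this is twice the relation f(xa ya) = f(ya xa). *)
Definition right_quantum r (f : biword r -> int) : Prop :=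
  forall be ga x y a b, rq_at f be ga x y a b.

Lemma emul_mono r (al be : biword r) : mono al ** mono be = mono (al ++ be).
Proof.
apply: functional_extensionality => de; rewrite /emul /mono.
have [->|ne] := eqVneq de (al ++ be).
  have lt : (size al < (size (al ++ be)).+1)%N by rewrite size_cat; lia.
  rewrite (bigD1 (Ordinal lt)) //= take_size_cat // drop_size_cat // !eqxx.
  rewrite big1 ?addr0 // => i ni; case: eqP => [e|_]; last by rewrite mul0r.
  case/eqP: ni; apply: val_inj => /=; rewrite -[al in RHS]e size_take.
  by case: ltnP => //; have := ltn_ord i; lia.
rewrite big1 // => i _; case: eqP => [e1|_]; last by rewrite mul0r.
case: eqP => [e2|_]; last by rewrite mulr0.
by case/eqP: ne; rewrite -[LHS](cat_take_drop i) e1 e2.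
Qed.

Lemma rule_emul r (be ga : biword r) (x y a b : 'I_r) : a != b ->
  mono be ** rule (x, a) (y, b) ** mono ga = fun de =>
    mono (be ++ [:: (y, b), (x, a) & ga]) de
    + mono (be ++ [:: (y, a), (x, b) & ga]) de
    - mono (be ++ [:: (x, b), (y, a) & ga]) de.
Proof.
move=> /negbTE ab; rewrite /rule ab.
have el E F G : mono be ** (fun de => E de + F de - G de) =
    fun de => (mono be ** E) de + (mono be ** F) de - (mono be ** G) de.
  apply: functional_extensionality => de; rewrite /emul -big_split -sumrB /=.
  by apply: eq_bigr => i _; rewrite mulrBr mulrDr.
have er E F G : (fun de => E de + F de - G de) ** mono ga =
    fun de => (E ** mono ga) de + (F ** mono ga) de - (G ** mono ga) de.
  apply: functional_extensionality => de; rewrite /emul -big_split -sumrB /=.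
  by apply: eq_bigr => i _; rewrite mulrBl mulrDl.
by rewrite el er !emul_mono -!catA.
Qed.

Definition red_coef r (de al : biword r) : int := reduce_rec (size al ^ 2) al de.

(** At the first double descent the relation is one reduction step, doubled when a = b. *)
Lemma red_coef_leftmost r (de be ga : biword r) (x y a b : 'I_r) :
  dd (x, a) (y, b) -> irreducible (rcons be (x, a)) ->
  rq_at (red_coef de) be ga x y a b.
Proof.
move=> d ir; have := @reduce_dd r be ga _ _ d ir de.
have [eab|ab] := eqVneq a b.
  subst b; rewrite /rule eqxx !emul_mono -catA !reduce_mono /=.
  by rewrite /rq_at /red_coef => ->.
rewrite rule_emul // => H; rewrite /rq_at /red_coef.
have rl E F G : reduce (fun de => E de + F de - G de) de =
    reduce E de + reduce F de - reduce G de :> int.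
  rewrite /reduce /linext -big_split -sumrB /=.
  by apply: eq_bigr => i _; rewrite mulrBl mulrDl.
by move: H; rewrite rl !reduce_mono => ->; rewrite subrK.
Qed.

(** Inversions between the factor and its surroundings depend only on the content of the factor. The
    form is additive to avoid truncated subtraction. *)
Lemma inv_cat_perm r (p s w w' : word r) : perm_eq w w' ->
  (inv (p ++ w ++ s) + inv w' = inv (p ++ w' ++ s) + inv w)%N.
Proof.
have cat w1 (s1 : word r) : inv (w1 ++ s1) = (inv w1 + inv s1 +
    \sum_(x <- w1) count (fun y : 'I_r => (y < x)%N) s1)%N.
  elim: w1 => [|z w1 IH]; last by rewrite /= !inv_cons IH count_cat big_cons; lia.
  by rewrite big_nil addn0 /= [in RHS]/inv eq_card0 // => -[[]].
move=> ww'; rewrite !cat (perm_big w') //=.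
have -> : (\sum_(x <- p) count (fun y : 'I_r => (y < x)%N) (w ++ s) =
    \sum_(x <- p) count (fun y : 'I_r => (y < x)%N) (w' ++ s))%N.
  by apply: eq_bigr => x _; rewrite !count_cat; congr addn; apply/seq.permP.
lia.
Qed.

Definition inv3 (x y z : nat) : nat := ((y < x) + (z < x) + (z < y))%N.

(* The antisymmetrization over the top row of the symmetrization over the bottom
   row is a signed sum of nine relations at the first two positions, and also of
   nine relations at the last two. When bottom letters coincide, some of the
   latter coincide with the one to be proved, which then has multiplicity 2 or 3. *)
Lemma rq_overlap r (F : 'I_r -> 'I_r -> 'I_r -> 'I_r -> 'I_r -> 'I_r -> int)
    (x y z a b c : 'I_r) :
  (y < x)%N -> (z < y)%N -> (b <= a)%N -> (c <= b)%N ->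
  let lower (x' y' z' a' b' c' : 'I_r) := (inv3 x' y' z' + inv3 a' b' c' <
                                  inv3 x y z + inv3 a b c)%N in
  let R1 x' y' z' a' b' c' := F x' y' z' a' b' c' + F x' y' z' b' a' c' =
                              F y' x' z' b' a' c' + F y' x' z' a' b' c' in
  let R2 x' y' z' a' b' c' := F x' y' z' a' b' c' + F x' y' z' a' c' b' =
                              F x' z' y' a' c' b' + F x' z' y' a' b' c' in
  (forall x' y' z' a' b' c', lower x' y' z' a' b' c' ->
    perm_eq [:: x'; y'; z'] [:: x; y; z] ->
    perm_eq [:: a'; b'; c'] [:: a; b; c] ->
    (y' < x')%N -> (b' <= a')%N -> R1 x' y' z' a' b' c') ->
  (forall x' y' z' a' b' c', lower x' y' z' a' b' c' ->
    perm_eq [:: x'; y'; z'] [:: x; y; z] ->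
    perm_eq [:: a'; b'; c'] [:: a; b; c] ->
    (z' < y')%N -> (c' <= b')%N -> R2 x' y' z' a' b' c') ->
  R1 x y z a b c -> R2 x y z a b c.
Proof.
move=> yx zy ba cb lower R1 R2 H1 H2 E.
have p3 (u v w : 'I_r) : [/\ perm_eq [:: u; w; v] [:: u; v; w],
    perm_eq [:: v; u; w] [:: u; v; w], perm_eq [:: v; w; u] [:: u; v; w],
    perm_eq [:: w; u; v] [:: u; v; w] & perm_eq [:: u; v; w] [:: u; v; w]].
  by split; apply/seq.permP => P /=; lia.
have [t1 t2 t3 t4 t0] := p3 x y z; have [b1 b2 b3 b4 b0] := p3 a b c.
have zx := ltn_trans zy yx; have ca := leq_trans cb ba.
have [lt1 lt2 lt3 lt4] : [/\ inv3 x z y < inv3 x y z, inv3 y x z < inv3 x y z,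
    inv3 y z x < inv3 x y z & inv3 z x y < inv3 x y z]%N.
  by clear -yx zy; rewrite /inv3; split; lia.
have [lb1 lb2 lb3 lb4] : [/\ inv3 a c b <= inv3 a b c, inv3 b a c <= inv3 a b c,
    inv3 b c a <= inv3 a b c & inv3 c a b <= inv3 a b c]%N.
  by clear -ba cb; rewrite /inv3; split; lia.
pose D1 x' y' z' a' b' c' : int := F x' y' z' a' b' c' + F x' y' z' b' a' c'
  - (F y' x' z' b' a' c' + F y' x' z' a' b' c').
pose D2 x' y' z' a' b' c' : int := F x' y' z' a' b' c' + F x' y' z' a' c' b'
  - (F x' z' y' a' c' b' + F x' z' y' a' b' c').
have K1 x' y' z' a' b' c' : lower x' y' z' a' b' c' ->
    perm_eq [:: x'; y'; z'] [:: x; y; z] -> perm_eq [:: a'; b'; c'] [:: a; b; c] ->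
    (y' < x')%N -> (b' <= a')%N -> D1 x' y' z' a' b' c' = 0.
  by move=> l p q i j; have := H1 _ _ _ _ _ _ l p q i j; rewrite /R1 /D1 => ->; rewrite subrr.
have K2 x' y' z' a' b' c' : lower x' y' z' a' b' c' ->
    perm_eq [:: x'; y'; z'] [:: x; y; z] -> perm_eq [:: a'; b'; c'] [:: a; b; c] ->
    (z' < y')%N -> (c' <= b')%N -> D2 x' y' z' a' b' c' = 0.
  by move=> l p q i j; have := H2 _ _ _ _ _ _ l p q i j; rewrite /R2 /D2 => ->; rewrite subrr.
have E0 : D1 x y z a b c = 0 by apply/eqP; rewrite subr_eq0 E.
have strict (b' a' : 'I_r) : (b' <= a')%N -> b' = a' \/ (b' < a')%N.
  by rewrite leq_eqVlt => /orP[/eqP/val_inj|]; [left|right].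
(* If c = b, this is the assumed relation [E0] itself; otherwise exchanging b and c has removed an
   inversion, so the hypothesis on lower words applies. [E3] is similar. *)
have E1 : D1 x y z a c b = 0.
  have [eq|lt] := strict _ _ cb; first by rewrite -[RHS]E0 eq.
  apply: K1 => //; rewrite /lower ltn_add2l; clear -ba lt; rewrite /inv3; lia.
have E3 : D1 x y z b c a = 0.
  have [eq|lt] := strict _ _ ca.
    have eb : b = a by apply: val_inj => /=; clear -eq ba cb; subst c; lia.
    by rewrite -[RHS]E0 eq eb.
  apply: K1 => //; rewrite /lower ltn_add2l; clear -ba cb lt; rewrite /inv3; lia.
have d2 : D2 x y z b a c = 0 \/ D2 x y z b a c = D2 x y z a b c.
  have [eq|lt] := strict _ _ ba; first by right; rewrite eq.
  by left; apply: K2 => //; rewrite /lower ltn_add2l; clear -cb lt; rewrite /inv3; lia.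
have d4 : D2 x y z c a b = 0 \/ D2 x y z c a b = D2 x y z a b c.
  have [eq|lt] := strict _ _ ca.
    have eb : b = a by apply: val_inj => /=; clear -eq ba cb; subst c; lia.
    by right; rewrite eq eb.
  by left; apply: K2 => //; rewrite /lower ltn_add2l; clear -ba cb lt; rewrite /inv3; lia.
have key : (D1 x y z a b c + D1 x y z a c b + D1 x y z b c a
  - (D1 x z y a b c + D1 x z y a c b + D1 x z y b c a)
  + (D1 y z x a b c + D1 y z x a c b + D1 y z x b c a)) =
    D2 x y z a b c + D2 x y z b a c + D2 x y z c a b
  - (D2 y x z a b c + D2 y x z b a c + D2 y x z c a b)
  + (D2 z x y a b c + D2 z x y b a c + D2 z x y c a b) :> int.
  by rewrite /D1 /D2; ring.
have add_lower t t' s s' : (t < t' -> s <= s' -> t + s < t' + s')%N by lia.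
(* The other twelve terms have fewer inversions in the top row and no more in the bottom row, so
   they vanish. *)
move: key; rewrite E0 E1 E3 ?(K1 x z y) ?(K1 y z x) ?(K2 y x z) ?(K2 z x y) //;
  try exact: add_lower.
rewrite !(add0r, addr0, subr0) => e; suff /eqP : D2 x y z a b c = 0.
  by rewrite subr_eq0 => /eqP.
by move: e; case: d2 => ->; case: d4 => ->; clear; lia.
Qed.

Lemma rq_at_swap_top r (f : biword r -> int) be ga x y a b :
  rq_at f be ga x y a b -> rq_at f be ga y x a b.
Proof. by rewrite /rq_at addrC => ->; rewrite addrC. Qed.

Lemma rq_at_swap_bottom r (f : biword r -> int) be ga x y a b :
  rq_at f be ga x y a b -> rq_at f be ga x y b a.
Proof. by rewrite /rq_at => e; rewrite addrC e addrC. Qed.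

Lemma rq_at_same r (f : biword r -> int) be ga x a b : rq_at f be ga x x a b.
Proof. exact: addrC. Qed.

Lemma inv_triple r (x y z : 'I_r) : inv [:: x; y; z] = inv3 x y z.
Proof.
by rewrite !inv_cons /= [inv [::]]eq_card0 => [|[[]] //]; rewrite /inv3; lia.
Qed.

Lemma biinv_triple r (be ga : biword r) (x y z a b c x' y' z' a' b' c' : 'I_r) :
  perm_eq [:: x'; y'; z'] [:: x; y; z] -> perm_eq [:: a'; b'; c'] [:: a; b; c] ->
  (biinv (be ++ [:: (x', a'), (y', b'), (z', c') & ga])
     < biinv (be ++ [:: (x, a), (y, b), (z, c) & ga]))%N
  = (inv3 x' y' z' + inv3 a' b' c' < inv3 x y z + inv3 a b c)%N.
Proof.
move=> /(inv_cat_perm (unzip1 be) (unzip1 ga)) + /(inv_cat_perm (unzip2 be) (unzip2 ga)).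
by rewrite /biinv /unzip1 /unzip2 !map_cat /= !inv_triple; lia.
Qed.

Lemma inv_swap_le r (be ga : word r) (x y : 'I_r) :
  (y <= x)%N -> (inv (be ++ [:: y, x & ga]) <= inv (be ++ [:: x, y & ga]))%N.
Proof.
by rewrite leq_eqVlt => /orP[/eqP/val_inj-> //|/(inv_swap be ga)->].
Qed.

(** By induction on the inversions of both rows: a double descent that is not the first one either
    shares a biletter with the first one or is disjoint from it, and in both cases the leftmost
    relation transports the claim to words with fewer inversions. *)
Lemma red_coef_right_quantum r (de : biword r) : right_quantum (red_coef de).
Proof.
set f := red_coef de.
have main n be ga (x y a b : 'I_r) : (y < x)%N -> (b <= a)%N ->
    (biinv (be ++ [:: (x, a), (y, b) & ga]) < n)%N -> rq_at f be ga x y a b.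
  elim: n be ga x y a b => // n IH be ga x y a b yx ba lt.
  have d : dd (x, a) (y, b) by rewrite /dd /= yx.
  have := first_ddP (rcons be (x, a)).
  case: (first_dd _) => [[[[be1 [x1 a1]] [y1 b1]] ga1]|]; last exact: red_coef_leftmost.
  move=> [+ ir d1]; have /andP[/= yx1 ba1] := d1.
  have L ga' : rq_at f be1 ga' x1 y1 a1 b1 by exact: red_coef_leftmost.
  (* If [ga1] is empty, the first double descent ends at the biletter (x, a): this is the
     overlap. *)
  case: (lastP ga1) => [|ga2 u].
    rewrite -(cat1s (x1, a1)) catA cats1 cats1 => /rcons_inj[ebe ey eb].
    subst y1 b1 be.
    pose F x' y' z' a' b' c' := f (be1 ++ [:: (x', a'), (y', b'), (z', c') & ga]).
    have H := @rq_overlap r F x1 x y a1 a b yx1 yx ba1 ba.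
    rewrite /rq_at !cat_rcons; apply: H.
    - move=> x' y' z' a' b' c' l pt pb i j.
      apply: (IH be1 ((z', c') :: ga)) => //.
      apply: leq_trans (_ : biinv (rcons be1 (x1, a1) ++ [:: (x, a), (y, b) & ga]) <= n)%N => //.
      by rewrite cat_rcons biinv_triple.
    - move=> x' y' z' a' b' c' l pt pb i j.
      have := IH (rcons be1 (x', a')) ga y' z' b' c' i j.
      rewrite /rq_at !cat_rcons; apply.
      apply: leq_trans (_ : biinv (rcons be1 (x1, a1) ++ [:: (x, a), (y, b) & ga]) <= n)%N => //.
      by rewrite cat_rcons biinv_triple.
    - exact: L.
  (* The two double descents are disjoint. Rewriting the first one yields words to which the
     induction hypothesis applies at the second; if b1 = a1, one of these words is the original
     one. *)
  rewrite -!rcons_cons -rcons_cat => /rcons_inj[ebe eu]; subst u be.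
  have bi u v : (biinv (be1 ++ [:: u, v & ga2 ++ [:: (x, a), (y, b) & ga]]) <
      biinv (be1 ++ [:: (x1, a1), (y1, b1) & ga2 ++ [:: (x, a), (y, b) & ga]]))%N ->
      rq_at f (be1 ++ [:: u, v & ga2]) ga x y a b.
    by move=> l; apply: IH => //; rewrite -catA; apply: leq_trans l _; rewrite -catA in lt.
  have D1 : rq_at f (be1 ++ [:: (y1, b1), (x1, a1) & ga2]) ga x y a b.
    apply: bi; rewrite /biinv /unzip1 /unzip2 !map_cat /= !map_cat /= (inv_swap _ _ yx1).
    by rewrite addSn ltnS leq_add2l; apply: inv_swap_le.
  have D2 : rq_at f (be1 ++ [:: (y1, a1), (x1, b1) & ga2]) ga x y a b.
    by apply: bi; rewrite /biinv /unzip1 /unzip2 !map_cat /= !map_cat /= (inv_swap _ _ yx1) addSn.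
  have D3 : b1 = a1 \/ rq_at f (be1 ++ [:: (x1, b1), (y1, a1) & ga2]) ga x y a b.
    move: ba1; rewrite leq_eqVlt => /orP[/eqP/val_inj|l]; [by left|right].
    by apply: bi; rewrite /biinv /unzip1 /unzip2 !map_cat /= !map_cat /= (inv_swap _ _ l) addnS.
  pose g (u v s t : biletter r) := f (be1 ++ [:: u, v & ga2 ++ [:: s, t & ga]]).
  pose D u v : int := g u v (x, a) (y, b) + g u v (x, b) (y, a)
    - (g u v (y, b) (x, a) + g u v (y, a) (x, b)).
  have rqD u v : rq_at f (be1 ++ [:: u, v & ga2]) ga x y a b <-> D u v = 0.
    rewrite /rq_at -!catA /= /D /g.
    by split=> [->|/eqP]; [rewrite subrr | rewrite subr_eq0 => /eqP].
  (* [D u v] is the defect of the relation at the second place when u v stands at the first. The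
     leftmost relation holds for each of the four continuations in a defect, hence between the
     defects. *)
  have LD : D (x1, a1) (y1, b1) + D (x1, b1) (y1, a1)
      = D (y1, b1) (x1, a1) + D (y1, a1) (x1, b1).
    have Lg s t : g (x1, a1) (y1, b1) s t + g (x1, b1) (y1, a1) s t
      = g (y1, b1) (x1, a1) s t + g (y1, a1) (x1, b1) s t by exact: L.
    have := Lg (x, a) (y, b); have := Lg (x, b) (y, a).
    have := Lg (y, b) (x, a); have := Lg (y, a) (x, b).
    rewrite /D; clearbody g; clear; lia.
  move/rqD: D1 LD => ->; move/rqD: D2 => ->; move=> LD; apply/rqD.
  case: D3 LD => [->|/rqD->]; last by rewrite !addr0.
  by set e := D _ _; clearbody e; clear; lia.
move=> be ga x y a b; wlog yx : x y / (y < x)%N => [W|].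
  case: (ltngtP x y) => [l|l|/val_inj->]; last exact: rq_at_same; last exact: W.
  by apply/rq_at_swap_top/W.
wlog ba : a b / (b <= a)%N => [W|]; last exact: main (ltnSn _).
by case: (leqP b a) => [|/ltnW] l; last apply: rq_at_swap_bottom; exact: W.
Qed.

(** * Adjacent swaps and sums over all arrangements of a word *)

(** Adjacent transpositions generate all rearrangements. The length is fixed because the sums below
    are invariant under swaps only when their rows have matching lengths. *)
Lemma perm_eq_swap_ind (T : eqType) A (n : nat) (phi : seq T -> A) :
  (forall s1 x y s2, size (s1 ++ [:: x, y & s2]) = n ->
    phi (s1 ++ [:: x, y & s2]) = phi (s1 ++ [:: y, x & s2])) ->
  forall s s', size s = n -> perm_eq s s' -> phi s = phi s'.
Proof.
move=> swap.
have move_right x s2 s1 pre : size (pre ++ x :: s1 ++ s2) = n ->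
    phi (pre ++ x :: s1 ++ s2) = phi (pre ++ s1 ++ x :: s2).
  elim: s1 pre => //= y s1 IH pre sz; rewrite swap // -(cat_rcons y) IH ?cat_rcons //.
  by rewrite -sz !size_cat.
suff main s s' pre : size (pre ++ s) = n -> perm_eq s s' -> phi (pre ++ s) = phi (pre ++ s').
  by move=> s s'; apply: (main s s' [::]).
elim: s s' pre => [|x s IH] s' pre sz ss'; first by move: ss'; rewrite perm_sym => /perm_nilP->.
have xs' : x \in s' by rewrite -(perm_mem ss') mem_head.
case/splitPr: xs' ss' => s1 s2; rewrite perm_sym perm_catC /= perm_cons perm_catC perm_sym => ss'.
rewrite -cat_rcons (IH _ _ _ ss') ?cat_rcons // move_right // -sz.
by rewrite !size_cat /= (perm_size ss') size_cat.
Qed.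

Definition swap_at (T : Type) i (s : seq T) :=
  take i s ++ rev (take 2 (drop i s)) ++ drop i.+2 s.

Lemma swap_at_cat (T : Type) (s1 s2 : seq T) x y :
  swap_at (size s1) (s1 ++ [:: x, y & s2]) = s1 ++ [:: y, x & s2].
Proof.
rewrite /swap_at take_size_cat // drop_size_cat //= take0 /rev /=; congr cat.
by rewrite -addn2 addnC -drop_drop drop_size_cat //= drop0.
Qed.

Lemma split_at2 (T : Type) i (s : seq T) : (i.+1 < size s)%N ->
  exists s1 x y s2, s = s1 ++ [:: x, y & s2] /\ size s1 = i.
Proof.
move=> lt; have := cat_take_drop i s; have := size_drop i s.
case: (drop i s) => [|x [|y s2]] /= sz <-; try lia.
by exists (take i s), x, y, s2; rewrite size_takel //; lia.
Qed.

Lemma perm_swap_at (T : eqType) i (s : seq T) : (i.+1 < size s)%N -> perm_eq (swap_at i s) s.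
Proof.
move=> /split_at2[s1 [x [y [s2 [-> <-]]]]].
by rewrite swap_at_cat perm_cat2l; apply/seq.permP => P /=; lia.
Qed.

Lemma swap_atK (T : Type) i (s : seq T) : (i.+1 < size s)%N -> swap_at i (swap_at i s) = s.
Proof. by move=> /split_at2[s1 [x [y [s2 [-> <-]]]]]; rewrite !swap_at_cat. Qed.

Lemma sum_permutations_swap (T : eqType) (V : nmodType) i (s : seq T) (g : seq T -> V) :
  (i.+1 < size s)%N ->
  \sum_(t <- permutations s) g t = \sum_(t <- permutations s) g (swap_at i t).
Proof.
move=> lt; rewrite -(big_map (swap_at i) predT g); apply: perm_big.
have sz t : t \in permutations s -> (i.+1 < size t)%N.
  by rewrite mem_permutations => /perm_size->.
apply: uniq_perm (permutations_uniq s) _ _.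
  rewrite map_inj_in_uniq ?permutations_uniq // => t t' /sz lt1 /sz lt2 e.
  by rewrite -(swap_atK lt1) e swap_atK.
move=> t; apply/idP/mapP => [ts|[t' t's ->]].
  exists (swap_at i t); last by rewrite swap_atK // sz.
    rewrite mem_permutations; apply: perm_trans (perm_swap_at (sz _ ts)) _.
    by rewrite -mem_permutations.
rewrite mem_permutations; apply: perm_trans (perm_swap_at (sz _ t's)) _.
  by rewrite -mem_permutations.
Qed.

(** * Symmetrizing bottom words and alternating top words *)

(** One equation with two uses: summing over both orders of a, b gives symmetry in x, y, and
    alternating over both orders of x, y gives antisymmetry in a, b. *)
Lemma rq_swap r (f : biword r -> int) t1 J1 (x y a b : 'I_r) t2 J2 :
  right_quantum f -> size t1 = size J1 ->
  f (biw (t1 ++ [:: x, y & t2]) (J1 ++ [:: a, b & J2]))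
    + f (biw (t1 ++ [:: x, y & t2]) (J1 ++ [:: b, a & J2]))
  = f (biw (t1 ++ [:: y, x & t2]) (J1 ++ [:: a, b & J2]))
    + f (biw (t1 ++ [:: y, x & t2]) (J1 ++ [:: b, a & J2])).
Proof. by move=> rq sz; rewrite /biw !zip_cat //= [RHS]addrC; apply: rq. Qed.

Lemma sign_inv_swap r (be ga : word r) x y : x != y ->
  (-1) ^+ inv (be ++ [:: y, x & ga]) = - (-1) ^+ inv (be ++ [:: x, y & ga]) :> int.
Proof.
move=> ne; case: (ltngtP x y) => [lt|lt|/val_inj e]; last by rewrite e eqxx in ne.
  by rewrite inv_swap // exprS mulN1r.
by rewrite [in RHS]inv_swap // exprS mulN1r opprK.
Qed.

Lemma sum_bottom_swap_top r (f : biword r -> int) (t J p1 p2 q : word r) x y :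
  right_quantum f -> size t = size J -> size (p1 ++ [:: x, y & p2]) = size q ->
  \sum_(w <- permutations q) f (biw (t ++ p1 ++ [:: x, y & p2]) (J ++ w)) =
  \sum_(w <- permutations q) f (biw (t ++ p1 ++ [:: y, x & p2]) (J ++ w)).
Proof.
move=> rq sz szq; set F := fun p w => f (biw (t ++ p) (J ++ w)).
have lt : ((size p1).+1 < size q)%N by rewrite -szq size_cat /=; lia.
(* Pairing each w with its swap doubles both sums, and the factor 2 cancels over the integers. *)
suff : \sum_(w <- permutations q) (F (p1 ++ [:: x, y & p2]) w
         + F (p1 ++ [:: x, y & p2]) (swap_at (size p1) w)) =
       \sum_(w <- permutations q) (F (p1 ++ [:: y, x & p2]) w
         + F (p1 ++ [:: y, x & p2]) (swap_at (size p1) w)).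
  rewrite !big_split /= -!(sum_permutations_swap (F _) lt).
  by set S := (\sum_(_ <- _) _); set S' := (\sum_(_ <- _) F (p1 ++ [:: y, x & p2]) _); clear; lia.
rewrite !big_seq; apply: eq_bigr => w; rewrite mem_permutations => /perm_size szw.
rewrite -szw in lt; have [w1 [a [b [w2 [-> s1]]]]] := split_at2 lt.
by rewrite -s1 swap_at_cat /F !catA rq_swap // !size_cat sz s1.
Qed.

Lemma sum_top_swap_bottom r (f : biword r -> int) (I p J1 J2 : word r) a b :
  right_quantum f -> uniq I -> ((size J1).+1 < size I)%N ->
  \sum_(t <- permutations I) (-1) ^+ inv t * f (biw (t ++ p) (J1 ++ [:: a, b & J2])) =
  - \sum_(t <- permutations I) (-1) ^+ inv t * f (biw (t ++ p) (J1 ++ [:: b, a & J2])).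
Proof.
move=> rq uI lt; apply/eqP; rewrite -addr_eq0 -big_split /=.
set h := fun t => f (biw (t ++ p) (J1 ++ [:: a, b & J2]))
  + f (biw (t ++ p) (J1 ++ [:: b, a & J2])).
under eq_bigr => t _ do rewrite -mulrDr -/(h t).
(* Swapping the two letters of t above a and b preserves h by [rq_swap] and reverses the sign, as
   these letters differ; so the sum equals its own negative. *)
suff : \sum_(t <- permutations I) (-1) ^+ inv t * h t =
     - \sum_(t <- permutations I) (-1) ^+ inv t * h t.
  by set S := (\sum_(_ <- _) _); move=> e; apply/eqP; move: e; clearbody S; clear; lia.
rewrite [LHS](sum_permutations_swap _ lt) -sumrN !big_seq.
apply: eq_bigr => t; rewrite mem_permutations => tI.
move: lt; rewrite -(perm_size tI) => lt.
move: (perm_uniq tI) (split_at2 lt) => /[swap] -[t1 [x [y [t2 [-> s1]]]]].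
rewrite uI -s1 swap_at_cat => ut; rewrite sign_inv_swap ?mulNr /h; last first.
  by move: ut; rewrite cat_uniq /= inE; case: (x == y); rewrite ?andbF.
by rewrite -!catA /= rq_swap.
Qed.

(* I and J need not have the same length: when size I = (size J).+1, splitting off
   the first letter of w or the last letter of t gives the Koszul differential. *)
Definition mixed r (f : biword r -> int) (I p J q : word r) : int :=
  \sum_(t <- permutations I) \sum_(w <- permutations q)
    (-1) ^+ inv t * f (biw (t ++ p) (J ++ w)).

Lemma mixed_perm_top r (f : biword r -> int) (I p p' J q : word r) :
  right_quantum f -> size I = size J -> size p = size q -> perm_eq p p' ->
  mixed f I p J q = mixed f I p' J q.
Proof.
move=> rq sIJ sz pp'; apply: eq_big_seq => t; rewrite mem_permutations => /perm_size st.
rewrite -!mulr_sumr; congr (_ * _).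
pose phi s := \sum_(w <- permutations q) f (biw (t ++ s) (J ++ w)).
apply: (perm_eq_swap_ind (n := size q) (phi := phi) _ sz pp') => s1 x y s2 ss.
by apply: sum_bottom_swap_top; rewrite ?st.
Qed.

Lemma mixed_swap_bottom r (f : biword r -> int) (I p J1 J2 q : word r) a b :
  right_quantum f -> uniq I -> ((size J1).+1 < size I)%N ->
  mixed f I p (J1 ++ [:: a, b & J2]) q = - mixed f I p (J1 ++ [:: b, a & J2]) q.
Proof.
move=> rq uI lt; rewrite /mixed exchange_big [in RHS]exchange_big -sumrN.
by apply: eq_bigr => w _; rewrite -!catA /=; apply: sum_top_swap_bottom.
Qed.

Lemma mixed_perm_bottom r (f : biword r -> int) (I p J J' q : word r) :
  right_quantum f -> uniq I -> size J = size I -> perm_eq J J' ->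
  (-1) ^+ inv J * mixed f I p J q = (-1) ^+ inv J' * mixed f I p J' q.
Proof.
move=> rq uI; pose phi s := (-1) ^+ inv s * mixed f I p s q.
apply: (perm_eq_swap_ind (phi := phi)) => s1 x y s2 ss.
have [->//|ne] := eqVneq x y; rewrite /phi mixed_swap_bottom //; last first.
  by rewrite -ss size_cat /=; lia.
by rewrite (sign_inv_swap _ _ ne) mulrN mulNr.
Qed.

(** Two equal letters can be made adjacent at the cost of a sign; swapping them then changes the
    sign but not the word. *)
Lemma mixed_nonuniq r (f : biword r -> int) (I p J q : word r) :
  right_quantum f -> uniq I -> size J = size I -> ~~ uniq J ->
  mixed f I p J q = 0.
Proof.
move=> rq uI sz nu; have [a [J' JJ']] : exists a J', perm_eq J [:: a, a & J'].
  elim: J nu {sz} => //= x J IH; have [xJ _|nx /IH[a [J' JJ']]] := boolP (x \in J).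
    by exists x, (rem x J); rewrite perm_cons perm_to_rem.
  exists a, (x :: J'); move: JJ'; rewrite -(perm_cons x) => /perm_trans; apply.
  by apply/seq.permP => P /=; lia.
have lt : ((size (Nil 'I_r)).+1 < size I)%N by rewrite -sz (perm_size JJ').
have := mixed_swap_bottom p J' q a a rq uI lt.
have := mixed_perm_bottom p q rq uI sz JJ'; rewrite /=; set z := mixed _ _ _ [:: a, a & J'] _.
move=> + e0; have -> : z = 0 by move: e0; clearbody z; clear; lia.
by rewrite mulr0 => /eqP; rewrite mulf_eq0 signr_eq0 => /eqP.
Qed.

Lemma mixed_perm_words r (f : biword r -> int) (I p J q q' : word r) :
  perm_eq q q' -> mixed f I p J q = mixed f I p J q'.
Proof.
by move=> qq'; apply: eq_bigr => t _; apply: perm_big; apply: perm_permutations.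
Qed.

Lemma mixed_first_bottom r (f : biword r -> int) (I p J q : word r) :
  (0 < size q)%N ->
  mixed f I p J q = \sum_(b <- undup q) mixed f I p (rcons J b) (rem b q).
Proof.
move=> q0; rewrite /mixed [RHS]exchange_big; apply: eq_bigr => t _ /=.
rewrite (perm_big _ (permutationsE q0)) big_allpairs_dep /=.
by apply: eq_bigr => b _; apply: eq_bigr => w _; rewrite cat_rcons.
Qed.

Lemma sum_permutations_rev (T : eqType) (V : nmodType) (s : seq T) (g : seq T -> V) :
  \sum_(t <- permutations s) g t = \sum_(t <- permutations s) g (rev t).
Proof.
rewrite -(big_map rev predT g); apply: perm_big; apply: uniq_perm.
- exact: permutations_uniq.
- by rewrite map_inj_uniq ?permutations_uniq //; apply: can_inj (@revK T).
have pr (t : seq T) : (t \in permutations s) = (rev t \in permutations s).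
  by rewrite !mem_permutations perm_rev.
move=> t; apply/idP/mapP => [ts|[t' t's ->]]; last by rewrite -pr.
by exists (rev t); rewrite ?revK // -pr.
Qed.

Lemma inv_rcons r (t : word r) x :
  inv (rcons t x) = (inv t + count (fun y : 'I_r => (x < y)%N) t)%N.
Proof.
elim: t => [|y t IH]; first by rewrite inv_cons addnC.
by rewrite /= !inv_cons IH -cats1 count_cat /=; lia.
Qed.

Lemma mixed_last_top r (f : biword r -> int) (I p J q : word r) :
  uniq I -> (0 < size I)%N ->
  mixed f I p J q = \sum_(x <- I) (-1) ^+ count (fun y : 'I_r => (x < y)%N) I
    * mixed f (rem x I) (x :: p) J q.
Proof.
(* [permutationsE] splits off the first letter, so t is reversed to reach its last one. That letter
   x forms an inversion with each larger letter of I, whence the sign. *)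
move=> uI I0; rewrite /mixed sum_permutations_rev.
rewrite (perm_big _ (permutationsE I0)) big_allpairs_dep /= undup_id //.
apply: eq_big_seq => x xI.
rewrite sum_permutations_rev mulr_sumr; apply: eq_big_seq => t.
rewrite mem_permutations => tx; rewrite mulr_sumr; apply: eq_bigr => w _.
rewrite rev_cons revK cat_rcons inv_rcons exprD mulrA [X in X * _]mulrC.
have -> // : count (fun y : 'I_r => (x < y)%N) t = count (fun y : 'I_r => (x < y)%N) I.
by rewrite (seq.permP tx) (seq.permP (perm_to_rem xI)) /= ltnn.
Qed.

(** * The Koszul complex of a fixed content and its alternating trace *)

(** The multiset difference m - J, meaningful when J is contained in m; it indexes the symmetric
    factor. *)
Definition rest r (m : word r) (J : {set 'I_r}) : word r :=
  foldr (fun x s => rem x s) m (enum J).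

Lemma perm_rest r (m : word r) (J : {set 'I_r}) :
  {subset J <= m} -> perm_eq (enum J ++ rest m J) m.
Proof.
move=> sJ; have {sJ} sJ : {subset enum J <= m} by move=> x; rewrite mem_enum; apply: sJ.
rewrite /rest; move: (enum_uniq J) sJ; elim: (enum J) => //= x s IH /andP[xs us] sm.
have pm : perm_eq (s ++ foldr (fun x s => rem x s) m s) m.
  by apply: IH us _ => y ys; apply: sm; rewrite inE ys orbT.
have /perm_to_rem xR : x \in foldr (fun x s => rem x s) m s.
  by have := sm x (mem_head _ _); rewrite -(perm_mem pm) mem_cat (negbTE xs).
apply: perm_trans pm; apply/seq.permP => P; have /= := seq.permP xR P.
by rewrite /= !count_cat; lia.
Qed.

Lemma enum_setU1 r (x : 'I_r) (K : {set 'I_r}) :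
  x \notin K -> perm_eq (enum (x |: K)) (x :: enum K).
Proof.
move=> xK; apply: uniq_perm; rewrite ?enum_uniq //= ?mem_enum ?xK ?enum_uniq //.
by move=> y; rewrite mem_enum !inE mem_enum.
Qed.

Lemma rem_enum r (x : 'I_r) (K : {set 'I_r}) : rem x (enum K) = enum (K :\ x).
Proof.
rewrite rem_filter ?enum_uniq // /enum_mem -filter_predI; apply: eq_filter => y.
by rewrite /= !inE.
Qed.

Lemma inv_sorted r (s : word r) : sorted (fun x y : 'I_r => (x < y)%N) s -> inv s = 0%N.
Proof.
elim: s => [|x s IH]; first by rewrite [inv [::]]eq_card0 // => -[[]].
move=> /= px; rewrite inv_cons IH ?(path_sorted px) // addn0.
have tr : transitive (fun x y : 'I_r => (x < y)%N) by move=> ? ? ?; apply: ltn_trans.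
apply/eqP; rewrite eqn0Ngt -has_count -all_predC.
by apply: sub_all (order_path_min tr px) => y /= xy; rewrite -leqNgt ltnW.
Qed.

Lemma inv_enum r (K : {set 'I_r}) : inv (enum K) = 0%N.
Proof.
apply: inv_sorted; rewrite /enum_mem.
have tr : transitive (fun x y : 'I_r => (x < y)%N) by move=> ? ? ?; apply: ltn_trans.
apply: sorted_filter => //; rewrite -enumT.
by have := iota_ltn_sorted 0 r; rewrite -val_enum_ord sorted_map.
Qed.

(** The exponent of the Koszul sign: the inversions created by appending x to [enum K]. *)
Definition above r (x : 'I_r) (K : {set 'I_r}) : nat :=
  count (fun y : 'I_r => (x < y)%N) (enum K).

Lemma above_setU1 r (x y : 'I_r) (K : {set 'I_r}) :
  y \notin K -> above x (y |: K) = ((x < y) + above x K)%N.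
Proof. by move=> yK; rewrite /above (seq.permP (enum_setU1 yK)). Qed.

Lemma above_setD1 r (x : 'I_r) (K : {set 'I_r}) : above x (K :\ x) = above x K.
Proof.
have [xK|xK] := boolP (x \in K).
  by rewrite -[in RHS](setD1K xK) above_setU1 ?setD11 // ltnn.
by rewrite (setDidPl _) // disjoint_sym disjoints1.
Qed.

(* T I J plays the role of the matrix entry from I to J, and the hypothesis is the
   commutation with the differential; the off-diagonal entries cancel in the sum
   over K of its instances because removing x from M |: K and adding M to K :\ x
   differ by a sign. *)
Lemma koszul_trace r (S : {set 'I_r}) (M : 'I_r) (T : {set 'I_r} -> {set 'I_r} -> int) :
  M \in S -> {in S, forall x : 'I_r, (x <= M)%N} ->
  (forall K : {set 'I_r}, K \subset S :\ M ->
    \sum_(b in S :\: K) (-1) ^+ above b K * T (M |: K) (b |: K) =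
    \sum_(x in M |: K) (-1) ^+ above x (M |: K) * T ((M |: K) :\ x) K) ->
  \sum_(J : {set 'I_r} | J \subset S) (-1) ^+ #|J| * T J J = 0.
Proof.
move=> MS maxM comm; pose S' := S :\ M.
have lt x : x \in S' -> (x < M)%N.
  by rewrite 2!inE => /andP[ne xS]; rewrite ltn_neqAle (maxM _ xS) andbT.
have MK (K : {set 'I_r}) : K \subset S' -> M \notin K.
  by move=> /subsetP KS; apply/negP => /KS; rewrite !inE eqxx.
have above_max (K : {set 'I_r}) : K \subset S' -> above M K = 0%N.
  move=> KS; apply/eqP; rewrite /above eqn0Ngt -has_count; apply/hasPn => x.
  by rewrite mem_enum => /(subsetP KS)/lt xM; rewrite -leqNgt ltnW.
(* The terms b = M and x = M are isolated; their sign is +1 because M is largest. Any other x has M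
   above it in M |: K, which produces the minus sign. *)
have {}comm (K : {set 'I_r}) : K \subset S' ->
    T (M |: K) (M |: K) + \sum_(b in S' :\: K) (-1) ^+ above b K * T (M |: K) (b |: K) =
    T K K - \sum_(x in K) (-1) ^+ above x K * T (M |: (K :\ x)) K.
  move=> KS; have := comm K KS; have nM := MK K KS.
  rewrite (bigD1 M) /=; last by rewrite !inE nM.
  rewrite [in RHS](bigD1 M) /= ?setU11 // setU1K // above_setU1 // ltnn.
  rewrite (above_max K KS) expr0 !mul1r -sumrN => e.
  have -> : \sum_(b in S' :\: K) (-1) ^+ above b K * T (M |: K) (b |: K) =
      \sum_(b in S :\: K | b != M) (-1) ^+ above b K * T (M |: K) (b |: K).
    by apply: eq_bigl => b; rewrite !inE; case: (b == M); rewrite ?andbF ?andbT.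
  rewrite e.
  congr (_ + _); apply: eq_big => [x|x].
    rewrite !inE; have [e1|_] /= := eqVneq x M; last by rewrite andbT.
    by rewrite e1; apply/esym/negbTE.
  rewrite !inE => /andP[/orP[/eqP->|xK] ne]; first by rewrite eqxx in ne.
  rewrite above_setU1 // lt ?(subsetP KS) // exprS mulN1r mulNr.
  congr (- (_ * T _ _)); apply/setP => y; rewrite !inE.
  by have [->|_] := eqVneq y M; rewrite //= (eq_sym M) ne.
have off : \sum_(K : {set 'I_r} | K \subset S') (-1) ^+ #|K| *
      (\sum_(b in S' :\: K) (-1) ^+ above b K * T (M |: K) (b |: K)) =
    - \sum_(K : {set 'I_r} | K \subset S') (-1) ^+ #|K| *
      (\sum_(x in K) (-1) ^+ above x K * T (M |: (K :\ x)) K).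
  rewrite -sumrN.
  under eq_bigr => K _ do rewrite mulr_sumr.
  under [in RHS]eq_bigr => K _ do rewrite mulr_sumr -sumrN.
  rewrite (exchange_big_dep (fun b => b \in S')) /=; last first.
    by move=> K b _; rewrite inE => /andP[].
  rewrite [RHS](exchange_big_dep (fun b => b \in S')) /=; last first.
    by move=> K b /subsetP; apply.
  apply: eq_bigr => b bS.
  (* Replacing K by K :\ b matches the terms of the two sums; the change of cardinality gives the
     sign. *)
  rewrite (reindex_onto (fun K => K :\ b) (fun K => b |: K)) /=; last first.
    by move=> K; rewrite inE bS andbT => /andP[_ bK]; rewrite setU1K.
  apply: eq_big => [K|K].
    rewrite in_setD bS in_setD1 eqxx /= andbT; apply/andP/andP => [[KS /eqP<-]|[KS bK]].
      by rewrite setU11 subUset sub1set bS KS.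
    by rewrite setD1K // eqxx (subset_trans (subD1set _ _) KS).
  rewrite in_setD => /andP[_ /eqP e]; rewrite e above_setD1.
  have bK : b \in K by rewrite -e setU11.
  by rewrite (cardsD1 b K) bK exprS mulN1r mulNr opprK.
(* Subsets of S pair off as K and M |: K, with opposite signs. *)
have split_M : \sum_(J : {set 'I_r} | J \subset S) (-1) ^+ #|J| * T J J =
    \sum_(K : {set 'I_r} | K \subset S') (-1) ^+ #|K| * (T K K - T (M |: K) (M |: K)).
  rewrite (bigID (fun J : {set 'I_r} => M \in J)) /= addrC.
  under [RHS]eq_bigr => K _ do rewrite mulrBr; rewrite [RHS]big_split /=; congr (_ + _).
    by apply: eq_bigl => K; rewrite subsetD1.
  rewrite (reindex_onto (fun K => M |: K) (fun K => K :\ M)) /=; last first.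
    by move=> K /andP[_ MK']; rewrite setD1K.
  apply: eq_big => [K|K /andP[_ /eqP e]].
    rewrite setU11 andbT subUset sub1set MS /= subsetD1.
    by congr andb; apply/eqP/idP => [<-|/setU1K //]; rewrite setD11.
  by rewrite cardsU1 -e setD11 exprS mulN1r mulNr.
rewrite split_M (eq_bigr (fun K : {set 'I_r} =>
      (-1) ^+ #|K| *
        (\sum_(b in S' :\: K) (-1) ^+ above b K * T (M |: K) (b |: K))
    + (-1) ^+ #|K| *
        (\sum_(x in K) (-1) ^+ above x K * T (M |: (K :\ x)) K))) => [|K KS].
  by rewrite big_split /= off addNr.
by rewrite -mulrDr; congr (_ * _); have := comm K KS; lia.
Qed.

Lemma rest_setU1 r (m : word r) (x : 'I_r) (K : {set 'I_r}) (q : word r) :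
  {subset K <= m} -> x \in m -> x \notin K ->
  perm_eq (x :: q) (rest m K) = perm_eq q (rest m (x |: K)).
Proof.
move=> Km xm xK; have xKm : {subset x |: K <= m}.
  by move=> y; rewrite !inE => /orP[/eqP->//|/Km].
rewrite -(perm_cat2l (enum K)) -[RHS](perm_cat2l (enum (x |: K))).
rewrite !(permPr (perm_rest _)) // -cat1s perm_catCA /=.
have e : perm_eq (enum (x |: K) ++ q) ((x :: enum K) ++ q) by rewrite perm_cat2r enum_setU1.
by rewrite (permPl e).
Qed.

Lemma size_rest r (m : word r) (K : {set 'I_r}) :
  {subset K <= m} -> (#|K| + size (rest m K) = size m)%N.
Proof. by move=> /perm_rest/perm_size <-; rewrite size_cat -cardE. Qed.

(** Both sides expand the same [mixed] sum, whose alternating top word M |: K is one letter longer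
    than K. Either the first letter of w joins K, where repeated letters contribute 0, or the last
    letter of t joins the symmetric part; sorting yields the signs. *)
Lemma mixed_koszul r (f : biword r -> int) (m : word r) (M : 'I_r) (K : {set 'I_r}) :
  right_quantum f -> {subset M |: K <= m} -> M \notin K ->
  let T (I J : {set _}) := mixed f (enum I) (rest m I) (enum J) (rest m J) in
  \sum_(b in [set x in m] :\: K) (-1) ^+ above b K * T (M |: K) (b |: K) =
  \sum_(x in M |: K) (-1) ^+ above x (M |: K) * T ((M |: K) :\ x) K.
Proof.
move=> rq sm nM T; pose I := M |: K.
have Km : {subset K <= m} by move=> x xK; apply: sm; rewrite !inE xK orbT.
have cI : #|I| = #|K|.+1 by rewrite cardsU1 nM.
have szI := size_rest sm; have szK := size_rest Km; rewrite -/I cI in szI.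
have q0 : (0 < size (rest m K))%N by lia.
have I0 : (0 < size (enum I))%N by rewrite -cardE cI.
have uI := enum_uniq I.
have memK x : x \in m -> x \notin K -> x \in rest m K.
  by move=> xm /negbTE xK; move: xm; rewrite -(perm_mem (perm_rest Km)) mem_cat mem_enum xK.
have left : mixed f (enum I) (rest m I) (enum K) (rest m K) =
    \sum_(b in [set x in m] :\: K) (-1) ^+ above b K * T I (b |: K).
  rewrite mixed_first_bottom // big_uniq ?undup_uniq //=.
  rewrite [LHS]big_mkcond [RHS]big_mkcond; apply: eq_bigr => b _.
  rewrite mem_undup !inE.
  have sb : size (rcons (enum K) b) = size (enum I) by rewrite size_rcons -!cardE cI.
  have [bK|bK] /= := boolP (b \in K).
    case: ifP => // _; rewrite mixed_nonuniq // rcons_uniq mem_enum bK //.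
  have [bm|bm] := boolP (b \in m); last first.
    case: ifP => // bq; case/negP: bm.
    by rewrite -(perm_mem (perm_rest Km)) mem_cat bq orbT.
  rewrite memK // /T.
  have -> : mixed f (enum I) (rest m I) (rcons (enum K) b) (rem b (rest m K)) =
      mixed f (enum I) (rest m I) (rcons (enum K) b) (rest m (b |: K)).
    by apply: mixed_perm_words; rewrite -rest_setU1 // perm_sym perm_to_rem // memK.
  have eK : perm_eq (rcons (enum K) b) (enum (b |: K)).
    by rewrite perm_rcons perm_sym enum_setU1.
  have := mixed_perm_bottom (rest m I) (rest m (b |: K)) rq uI sb eK.
  rewrite inv_enum expr0 mul1r inv_rcons inv_enum add0n => <-.
  by rewrite mulrA -expr2 sqrr_sign mul1r.
have right : mixed f (enum I) (rest m I) (enum K) (rest m K) =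
    \sum_(x in I) (-1) ^+ above x I * T (I :\ x) K.
  rewrite mixed_last_top // big_uniq //=; apply: eq_big => [x|x]; first by rewrite mem_enum.
  rewrite mem_enum => xI; rewrite /T rem_enum; congr (_ * _).
  have sx : {subset I :\ x <= m} by move=> y; rewrite inE => /andP[_ /sm].
  have cx : #|I :\ x| = #|K| by apply/eqP; rewrite -eqSS -cI (cardsD1 x I) xI.
  apply: mixed_perm_top => //; first by rewrite -!cardE cx.
    by rewrite /=; lia.
  by rewrite rest_setU1 ?sm ?setD11 // setD1K.
by rewrite -left right.
Qed.

Lemma mixed_trace r (f : biword r -> int) (m : word r) :
  right_quantum f -> (0 < size m)%N ->
  \sum_(J : {set 'I_r} | J \subset [set x in m])
    (-1) ^+ #|J| * mixed f (enum J) (rest m J) (enum J) (rest m J) = 0.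
Proof.
move=> rq m0; have [x0 x0m] : exists x, x \in m by case: m m0 => // x m; exists x; rewrite mem_head.
have [M Mm maxM] := @arg_maxnP _ x0 (fun x => x \in m) (fun x : 'I_r => x : nat) x0m.
apply: (@koszul_trace r _ M (fun I J : {set _} => mixed f (enum I) (rest m I) (enum J) (rest m J))).
- by rewrite inE.
- by move=> x; rewrite inE => /maxM.
move=> K; rewrite subsetD1 => /andP[/subsetP Km nM]; apply: mixed_koszul => // x.
by rewrite !inE => /orP[/eqP->//|/Km]; rewrite inE.
Qed.

(** * Expansion of the product of [Ferm] and [Bos] by content *)

Lemma sum_mono r k (al : biword r) (g : biword r -> int) : size al = k ->
  \sum_(de : k.-tuple (biletter r)) mono al de * g de = g al.
Proof.
move=> sz; have st : size al == k by apply/eqP.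
rewrite (bigD1 (Tuple st)) //= big1 => [|t nt]; first by rewrite /mono eqxx mul1r addr0.
rewrite /mono; case: eqP => [e|_]; last by rewrite mul0r.
by case/eqP: nt; apply: val_inj.
Qed.

Lemma size_biw r (u w : word r) : size u = size w -> size (biw u w) = size w.
Proof. by move=> e; rewrite size_zip e minnn. Qed.

Lemma size_nondec r (w : word r) : size (nondec w) = size w.
Proof. exact: size_sort. Qed.

Lemma Bos_size r k (ga : biword r) : size ga = k ->
  Bos r ga = \sum_(w : k.-tuple 'I_r) mono (biw (nondec w) w) ga.
Proof. by move=> <-. Qed.

Lemma sum_mono_emul_Bos r n (be : biword r) (g : biword r -> int) :
  \sum_(al : n.-tuple (biletter r)) (mono be ** Bos r) al * g al =
  if (size be <= n)%N
  then \sum_(w : (n - size be).-tuple 'I_r) g (be ++ biw (nondec w) w) else 0.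
Proof.
have emulE (al : n.-tuple (biletter r)) : (mono be ** Bos r) al = if (size be <= n)%N
    then \sum_(w : (n - size be).-tuple 'I_r) mono (be ++ biw (nondec w) w) al else 0.
  rewrite /emul; case: leqP => [le|lt].
    have lt : (size be < (size al).+1)%N by rewrite size_tuple ltnS.
    (* Only the cut of [al] at position [size be] contributes. *)
    rewrite (bigD1 (Ordinal lt)) //= [X in _ + X]big1 ?addr0 => [|i ni].
      rewrite (@Bos_size _ (n - size be)) ?size_drop ?size_tuple // mulr_sumr.
      apply: eq_bigr => w _; rewrite /mono -natrM mulnb -eqseq_cat ?cat_take_drop //.
      by rewrite size_takel // size_tuple.
    rewrite /mono; case: eqP => [e|_]; last by rewrite mul0r.
    case/eqP: ni; apply: val_inj => /=; rewrite -e size_takel //.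
    by rewrite -ltnS ltn_ord.
  rewrite big1 // => i _; rewrite /mono; case: eqP => [e|_]; last by rewrite mul0r.
  have := geq_minr i (size al); rewrite -size_take_min e => le.
  by move: (leq_trans lt le); rewrite [X in (_ < X)%N](size_tuple al) ltnn.
under eq_bigr => al _ do rewrite emulE.
case: leqP => [le|lt]; last by rewrite big1 // => al _; rewrite mul0r.
under eq_bigr => al _ do rewrite mulr_suml.
rewrite exchange_big; apply: eq_bigr => w _; apply: sum_mono.
by rewrite size_cat size_biw ?size_nondec // size_tuple subnKC.
Qed.

Lemma sum_Sym r (J : {set 'I_r}) (g : word r -> int) :
  \sum_(s in Sym J) g (map s (enum J)) = \sum_(t <- permutations (enum J)) g t.
Proof.
rewrite -big_enum -(big_map (fun s : {perm 'I_r} => map s (enum J)) predT g).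
apply: perm_big; set L := map _ _.
have uL : uniq L.
  rewrite map_inj_in_uniq ?enum_uniq // => s s'; rewrite !mem_enum !inE => sJ s'J e.
  apply/permP => x; have [xJ|xJ] := boolP (x \in J); last by rewrite !(out_perm _ xJ).
  by move/eq_in_map: e; apply; rewrite mem_enum.
have sL : {subset L <= permutations (enum J)}.
  move=> t /mapP[s]; rewrite mem_enum inE => sJ ->; rewrite mem_permutations.
  apply: uniq_perm; rewrite ?map_inj_uniq ?enum_uniq //; first exact: perm_inj.
  move=> x; rewrite mem_enum; apply/mapP/idP => [[y + ->]|xJ].
    by rewrite mem_enum (perm_closed _ sJ).
  exists (s^-1%g x); last by rewrite permKV.
  by rewrite mem_enum -(perm_closed _ sJ) permKV.
apply: uniq_perm => //; first exact: permutations_uniq.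
(* A permutation of J is determined by its word on [enum J], so it suffices to compare
   cardinalities, both equal to the factorial of #|J|. *)
suff le : (size (permutations (enum J)) <= size L)%N by case: (uniq_min_size uL sL le).
rewrite size_permutations ?enum_uniq // size_map -!cardE -card_perm.
by rewrite leq_eqVlt; apply/orP; left; apply/eqP/eq_card => s; rewrite !inE.
Qed.

Lemma perm_eq_nondec r (s s' : word r) : perm_eq s s' = (nondec s == nondec s').
Proof.
have tot : total (fun i j : 'I_r => (i <= j)%N) by move=> i j; apply: leq_total.
have tr : transitive (fun i j : 'I_r => (i <= j)%N) by move=> i j l; apply: leq_trans.
have anti : antisymmetric (fun i j : 'I_r => (i <= j)%N).
  by move=> i j ij; apply/val_inj/anti_leq.
by apply/(perm_sortP tot tr anti)/eqP.
Qed.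

Lemma nondec_perm r (s s' : word r) : perm_eq s s' -> nondec s = nondec s'.
Proof. by rewrite perm_eq_nondec => /eqP. Qed.

(** Words w are grouped by the content m of [enum J ++ w], recorded as a nondecreasing word so that
    each content occurs once. The range of m no longer depends on J, so the two sums can be
    exchanged. *)
Lemma sum_by_content r n (J : {set 'I_r}) (g : word r -> int) : (#|J| <= n)%N ->
  \sum_(w : (n - #|J|).-tuple 'I_r) g w =
  \sum_(m : n.-tuple 'I_r | nondec m == m)
    if J \subset [set x in val m] then \sum_(w <- permutations (rest m J)) g w else 0.
Proof.
move=> le; set k := (n - #|J|)%N.
pose content (w : k.-tuple 'I_r) := nondec (enum J ++ w).
have sc w : size (content w) == n.
  by rewrite size_nondec size_cat size_tuple -cardE subnKC.
rewrite (partition_big (fun w => Tuple (sc w)) (fun m : n.-tuple 'I_r => nondec m == m)) /=.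
  apply: eq_bigr => m /eqP nm; have cE w : (Tuple (sc w) == m) = perm_eq (enum J ++ w) m.
    by rewrite perm_eq_nondec nm -val_eqE.
  under eq_bigl => w do rewrite cE.
  case: ifP => [/subsetP Jm|/negbT Jm]; last first.
    rewrite big_pred0 // => w; apply: contraNF Jm => /perm_mem pm.
    by apply/subsetP => x xJ; rewrite inE -pm mem_cat mem_enum xJ.
  have {}Jm : {subset J <= val m} by move=> x /Jm; rewrite inE.
  under eq_bigl => w do rewrite -(permPr (perm_rest Jm)) perm_cat2l.
  rewrite -big_filter -(big_map val predT g) /=.
  apply: perm_big; apply: uniq_perm.
  - by rewrite map_inj_uniq ?filter_uniq ?index_enum_uniq //; apply: val_inj.
  - exact: permutations_uniq.
  move=> w; rewrite mem_permutations; apply/mapP/idP => [[w']|pw].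
    by rewrite mem_filter => /andP[pw _] ->.
  have sw : size w == k.
    have := size_rest Jm; rewrite size_tuple => szJ.
    by rewrite (perm_size pw) -(addKn #|J| (size _)) szJ.
  by exists (Tuple sw); rewrite // mem_filter pw mem_index_enum.
by move=> w _; rewrite -perm_eq_nondec perm_sort.
Qed.

(** The empty content. A variable length with an equation lets this apply to tuples of length
    [size de] without a cast. *)
Lemma mixed_trace0 r (f : biword r -> int) k : k = 0%N ->
  \sum_(m : k.-tuple 'I_r | nondec m == m)
    \sum_(J : {set 'I_r} | J \subset [set x in val m])
      (-1) ^+ #|J| * mixed f (enum J) (rest m J) (enum J) (rest m J) = f [::].
Proof.
move=> ->; rewrite (big_pred1 ([tuple] : 0.-tuple 'I_r)) => [|m]; last first.
  by rewrite [m]tuple0 /= !eqxx.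
rewrite (big_pred1 set0) => [|J /=]; last first.
  by rewrite (_ : [set x in _] = set0) ?subset0 //; apply/setP => x; rewrite !inE.
rewrite cards0 expr0 mul1r /mixed /rest enum_set0 /= !big_seq1 [inv [::]]eq_card0 => [|[[]] //].
by rewrite mul1r.
Qed.

Theorem corollary5 (r : nat) (r_ge2 : (2 <= r)%N) :
  reduce (Ferm r ** Bos r) = eone r.
Proof.
apply: functional_extensionality => de; set n := size de.
pose f := red_coef de; have rq : right_quantum f by exact: red_coef_right_quantum.
have emul_Ferm al : (Ferm r ** Bos r) al = \sum_(J : {set 'I_r}) \sum_(s in Sym J)
    (-1) ^+ #|J| * (-1) ^+ inv (map s (enum J)) *
    (mono (biw (map s (enum J)) (enum J)) ** Bos r) al.
  rewrite /emul /Ferm; under eq_bigr => i _ do rewrite mulr_suml.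
  rewrite exchange_big; apply: eq_bigr => J _ /=.
  under eq_bigr => i _ do rewrite -mulrA mulr_suml mulr_sumr.
  rewrite exchange_big; apply: eq_bigr => s _ /=; rewrite mulr_sumr.
  by apply: eq_bigr => i _; rewrite !mulrA.
have reduceE : reduce (Ferm r ** Bos r) de =
    \sum_(J : {set 'I_r} | (#|J| <= n)%N) (-1) ^+ #|J| *
      \sum_(w : (n - #|J|).-tuple 'I_r) \sum_(t <- permutations (enum J))
        (-1) ^+ inv t * f (biw (t ++ nondec w) (enum J ++ w)).
  rewrite /reduce /linext -/n; under eq_bigr => al _ do rewrite emul_Ferm mulr_suml.
  rewrite exchange_big [RHS]big_mkcond; apply: eq_bigr => J _ /=.
  under eq_bigr => al _ do rewrite mulr_suml.
  rewrite exchange_big /=.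
  pose G t := if (#|J| <= n)%N then \sum_(w : (n - #|J|).-tuple 'I_r)
     f (biw (t ++ nondec w) (enum J ++ w)) else 0.
  rewrite (eq_bigr (fun s : {perm 'I_r} => (-1) ^+ #|J| *
      ((-1) ^+ inv (map s (enum J)) * G (map s (enum J))))).
    rewrite -mulr_sumr (sum_Sym J (fun t => (-1) ^+ inv t * G t)) /G.
    case: ifP => _; last by rewrite big1 ?mulr0 // => t _; rewrite mulr0.
    by rewrite exchange_big; congr (_ * _); apply: eq_bigr => t _; rewrite mulr_sumr.
  move=> s _; have sb : size (biw (map s (enum J)) (enum J)) = #|J|.
    by rewrite size_biw ?size_map // -cardE.
  rewrite mulrA -(_ : \sum_(al : n.-tuple (biletter r))
    (mono (biw (map s (enum J)) (enum J)) ** Bos r) al * f al = G (map s (enum J))).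
    by rewrite mulr_sumr; apply: eq_bigr => al _; rewrite mulrA.
  rewrite sum_mono_emul_Bos sb /G; case: ifP => // _; apply: eq_bigr => w _.
  by rewrite /biw zip_cat // size_map.
rewrite reduceE {reduceE emul_Ferm}.
under eq_bigr => J Jn do rewrite (sum_by_content (fun w => \sum_(t <- permutations (enum J))
  (-1) ^+ inv t * f (biw (t ++ nondec w) (enum J ++ w))) Jn) mulr_sumr.
rewrite exchange_big /=.
have contentE (m : n.-tuple 'I_r) : \sum_(J : {set 'I_r} | (#|J| <= n)%N) (-1) ^+ #|J| *
    (if J \subset [set x in val m] then \sum_(w <- permutations (rest m J))
      \sum_(t <- permutations (enum J)) (-1) ^+ inv t * f (biw (t ++ nondec w) (enum J ++ w))
     else 0) =
    \sum_(J : {set 'I_r} | J \subset [set x in val m])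
      (-1) ^+ #|J| * mixed f (enum J) (rest m J) (enum J) (rest m J).
  rewrite big_mkcond [RHS]big_mkcond; apply: eq_bigr => J _.
  have [/subsetP Jm|_] := boolP (J \subset _); last by rewrite mulr0 if_same.
  have {}Jm : {subset J <= val m} by move=> x /Jm; rewrite inE.
  have szJ := size_rest Jm; rewrite size_tuple in szJ.
  have -> : (#|J| <= n)%N by apply: leq_trans (leq_addr _ _) (eq_leq szJ).
  congr (_ * _).
  (* The top row in [Bos] is the sorted word; by symmetry in the top word it may replace
     [rest m J]. *)
  have pn : perm_eq (rest m J) (nondec (rest m J)) by rewrite perm_sym perm_sort.
  rewrite (mixed_perm_top rq (erefl _) (erefl _) pn).
  rewrite /mixed [RHS]exchange_big; apply: eq_big_seq => w; rewrite mem_permutations => pw.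
  by rewrite (nondec_perm pw).
under eq_bigr => m _ do rewrite contentE.
(* In positive degree the trace of every content vanishes; in degree 0 only the coefficient of the
   empty biword remains. *)
have [e0|n0] := posnP n; last first.
  rewrite big1 => [|m _]; last by rewrite mixed_trace // size_tuple.
  by move: n0; rewrite /n /eone /mono; case: eqP => // ->.
have de0 : de = [::] by apply/size0nil.
by rewrite mixed_trace0 // /f de0.
Qed.
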